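(* Let $c_1,c_2,c_3\in(0,1)$ satisfy $c_1+c_2+c_3=2$. Then there exists a triple of directions (lines) $\mathbb{R}u_1,\mathbb{R}u_2,\mathbb{R}u_3$ in $\mathbb{R}^2$, with $u_1,u_2,u_3$ unit vectors, unique up to linear isometries of $\mathbb{R}^2$, such that $$c_1\,u_1\otimes u_1+c_2\,u_2\otimes u_2+c_3\,u_3\otimes u_3=\mathrm{Id}_{\mathbb{R}^2}.$$ The solutions $u_i=(\cos\theta_i,\sin\theta_i)$ are given by the equations $$\cot(\theta_2-\theta_3)=\varepsilon\sqrt{\tfrac{(1-c_2)(1-c_3)}{1-c_1}},\quad \cot(\theta_3-\theta_1)=\varepsilon\sqrt{\tfrac{(1-c_3)(1-c_1)}{1-c_2}},\quad \cot(\theta_1-\theta_2)=\varepsilon\sqrt{\tfrac{(1-c_1)(1-c_2)}{1-c_3}}$$ with $\varepsilon\in\{-1,1\}$. More explicitly, all solutions (as triples of directions) are obtained by applying a linear isometry of $\mathbb{R}^2$ to $$u_1=(1,0),\quad u_2=\left(\sqrt{\frac{(1-c_1)(1-c_2)}{c_1c_2}},\ \sqrt{\frac{1-c_3}{c_1c_2}}\right),\quad u_3=\left(-\sqrt{\frac{(1-c_1)(1-c_3)}{c_1c_3}},\ \sqrt{\frac{1-c_2}{c_1c_3}}\right).$$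
   Context: For a unit vector $u\in\mathbb{R}^2$, $u\otimes u$ denotes the orthogonal projection onto the line $\mathbb{R}u$, i.e. $(u\otimes u)(v)=(v\cdot u)u$; it depends only on the direction $\mathbb{R}u$ (so $u$ and $-u$ are identified). *)

(* Defs.v *)
From HB Require Import structures.
From mathcomp Require Import all_boot all_order all_algebra.
From mathcomp Require Import reals trigo.

Set Implicit Arguments.
Unset Strict Implicit.
Unset Printing Implicit Defensive.

Import Order.TTheory GRing.Theory Num.Theory.
Local Open Scope ring_scope.

Section Plane.
Variable R : realType.
Implicit Types (u v : 'rV[R]_2) (L : {vspace 'rV[R]_2}).

Definition vec2 (x y : R) : 'rV[R]_2 := \row_(j < 2) (if j == 0 then x else y).

Definition dot u v : R := \sum_(j < 2) u 0 j * v 0 j.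

(* MathComp-Analysis equips row vectors with the sup norm, so the Euclidean
   norm is defined here. *)
Definition enorm v : R := Num.sqrt (dot v v).

(* [tens u] is u (x) u, as a map of the plane. *)
Definition tens u v : 'rV[R]_2 := dot v u *: u.

Definition decomposes_id (c1 c2 c3 : R) u1 u2 u3 : Prop :=
  [/\ enorm u1 = 1, enorm u2 = 1, enorm u3 = 1 &
      forall v, c1 *: tens u1 v + c2 *: tens u2 v + c3 *: tens u3 v = v].

(* The choice of unit generators is immaterial, since [tens (- u)] and [tens u]
   agree pointwise. *)
Definition lines_decompose_id (c1 c2 c3 : R) L1 L2 L3 : Prop :=
  exists u1 u2 u3,
    [/\ L1 = <[u1]>%VS, L2 = <[u2]>%VS, L3 = <[u3]>%VS &
        decomposes_id c1 c2 c3 u1 u2 u3].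

Definition linear_isometry (f : 'End('rV[R]_2)) : Prop :=
  forall v, enorm (f v) = enorm v.

(* Takes the value 0 at the poles, because [0^-1 = 0]; in particular a nonzero
   value of [cot x] forces [sin x != 0]. *)
Definition cot (x : R) : R := cos x / sin x.

End Plane.

(* Main.v *)
(* In the orthonormal frame (u1, u1 turned by a right angle), write
   u_i = (p_i, s_i) for i = 2, 3. The decomposition of the identity says that
   c1 + c2 p2^2 + c3 p3^2 = 1, c2 p2 s2 + c3 p3 s3 = 0 and
   c2 s2^2 + c3 s3^2 = 1. With D^2 = (1 - c1)(1 - c2)(1 - c3) this amounts to
   p2 (1 - c3) = e D s2 and p3 (1 - c2) = - e D s3 for one common sign e:
   squaring the middle equation determines p_i^2 and s_i^2, and the same
   equation forces the two signs to be opposite. These linear equations fix the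
   two lines up to the reflection e -> - e of the frame, which gives uniqueness;
   in terms of angles they are two of the cotangent formulas, and the third one
   follows from kl + lm + mk = 1, the relation between the cotangents of three
   angles with sum 0. *)
Require Import Defs.
From HB Require Import structures.
From mathcomp Require Import all_boot all_order all_algebra.
From mathcomp Require Import reals trigo.
From mathcomp Require Import ring lra.

Set Implicit Arguments.
Unset Strict Implicit.
Unset Printing Implicit Defensive.

Import Order.TTheory GRing.Theory Num.Theory.
Local Open Scope ring_scope.

(** * Euclidean geometry of the plane: dot product, isometries, orthonormal frames *)

Section EuclideanPlane.
Variable R : realType.
Implicit Types (u v w : 'rV[R]_2) (f : 'End('rV[R]_2)).

Lemma vec2_0 (x y : R) : vec2 x y 0 0 = x.
Proof. by rewrite mxE. Qed.

Lemma vec2_1 (x y : R) : vec2 x y 0 1 = y.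
Proof. by rewrite mxE. Qed.

Lemma row2P u v : u 0 0 = v 0 0 -> u 0 1 = v 0 1 -> u = v.
Proof.
move=> e0 e1; apply/rowP => j.
by case: j => [[|[|//]] lt_j2]; [move: e0 | move: e1];
  congr (u 0 _ = v 0 _); apply: val_inj.
Qed.

Lemma dotE u v : dot u v = u 0 0 * v 0 0 + u 0 1 * v 0 1.
Proof.
rewrite /dot !big_ord_recl big_ord0 addr0.
by rewrite (_ : lift ord0 ord0 = 1) //; apply: val_inj.
Qed.

Lemma dotC u v : dot u v = dot v u.
Proof. by rewrite !dotE; ring. Qed.

Lemma dotDl u v w : dot (u + v) w = dot u w + dot v w.
Proof. by rewrite !dotE !mxE; ring. Qed.

Lemma dotZl (a : R) u v : dot (a *: u) v = a * dot u v.
Proof. by rewrite !dotE !mxE; ring. Qed.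

Lemma enorm1P u : enorm u = 1 <-> dot u u = 1.
Proof.
rewrite /enorm; split=> [h|->]; last exact: sqrtr1.
have dot_ge0 : 0 <= dot u u by rewrite dotE -!expr2 addr_ge0 ?sqr_ge0.
by rewrite -(sqr_sqrtr dot_ge0) h expr1n.
Qed.

(** Polarization: the squared norm of [u + v] recovers [dot u v]. *)
Lemma linear_isometryP f :
  linear_isometry f <-> forall u v, dot (f u) (f v) = dot u v.
Proof.
split=> [fi|fi v]; last by rewrite /enorm fi.
have dot_ge0 v : 0 <= dot v v by rewrite dotE -!expr2 addr_ge0 ?sqr_ge0.
have fsq v : dot (f v) (f v) = dot v v.
  by rewrite -[LHS]sqr_sqrtr // -[RHS]sqr_sqrtr //; congr (_ ^+ 2); apply: fi.
move=> u v; have := fsq (u + v); rewrite linearD !dotDl.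
rewrite ![dot _ (_ + _)]dotC !dotDl !fsq (dotC (f v)) (dotC v); lra.
Qed.

Lemma linear_isometry_lker0 f : linear_isometry f -> lker f == 0%VS.
Proof.
move=> /linear_isometryP fi; apply/lker0P => u v fuv.
have := fi (u - v) (u - v); rewrite linearB /= fuv subrr !dotE !mxE mul0r addr0.
move/esym/eqP; rewrite -!expr2 paddr_eq0 ?sqr_ge0 // !sqrf_eq0 => /andP[/eqP h0 /eqP h1].
by apply: row2P; lra.
Qed.

(** An isometry is invertible, so any vector is [f w]; since [f] preserves dot products, the
    identity to prove at [f w] is the image under [f] of the given one at [w]. *)
Lemma linear_isometry_decomposes_id (c1 c2 c3 : R) u1 u2 u3 f :
  linear_isometry f -> decomposes_id c1 c2 c3 u1 u2 u3 ->
  decomposes_id c1 c2 c3 (f u1) (f u2) (f u3).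
Proof.
move=> fi [n1 n2 n3 hid]; split; rewrite ?fi // => v.
have f0 := linear_isometry_lker0 fi.
rewrite -(lker0_lfunVK f0 v); set w := (f^-1)%VF v.
move/linear_isometryP: fi => fi.
rewrite /tens !fi -[in RHS](hid w) /tens !scalerA !linearD /=.
by congr (_ + _ + _); rewrite linearZ.
Qed.

Definition perp u : 'rV[R]_2 := vec2 (- u 0 1) (u 0 0).

Definition map_frame u u' (e : R) v : 'rV[R]_2 :=
  dot u v *: u' + (e * dot (perp u) v) *: perp u'.

Lemma map_frame_linear u u' e : linear (map_frame u u' e).
Proof.
by move=> a v w; apply: row2P; rewrite /map_frame !dotE !mxE /=; ring.
Qed.

HB.instance Definition _ u u' e :=
  GRing.isLinear.Build R _ _ _ (map_frame u u' e) (map_frame_linear u u' e).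

Lemma map_frame_isometry u u' (e : R) :
  dot u u = 1 -> dot u' u' = 1 -> e ^+ 2 = 1 ->
  linear_isometry (linfun (map_frame u u' e)).
Proof.
move=> hu hu' he v; rewrite lfunE /= /enorm; congr Num.sqrt.
have -> : dot (map_frame u u' e v) (map_frame u u' e v) =
    (dot u v ^+ 2 + e ^+ 2 * dot (perp u) v ^+ 2) * dot u' u'.
  by rewrite /map_frame !dotE !mxE /=; ring.
(* Inserting the factor [dot u u = 1] makes the claim homogeneous: it becomes Lagrange's identity,
   which [ring] proves. *)
have -> : dot v v = dot v v * dot u u by rewrite hu mulr1.
by rewrite he hu' !dotE !mxE /=; ring.
Qed.

Lemma frame_expand u v :
  dot u u = 1 -> v = dot u v *: u + dot (perp u) v *: perp u.
Proof.
rewrite dotE => hu; apply: row2P; rewrite !dotE !mxE /=.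
  by rewrite -[LHS]mul1r -hu; ring.
by rewrite -[LHS]mul1r -hu; ring.
Qed.


Lemma dot_frame u v w :
  dot u u = 1 -> dot v w = dot u v * dot u w + dot (perp u) v * dot (perp u) w.
Proof.
move=> hu; rewrite -[LHS]mul1r -hu !dotE !mxE /=; ring.
Qed.

(** The three equations are the entries of a symmetric 2 by 2 matrix: the operator is compared with
    the identity on pairs of vectors of the frame [(u1, perp u1)]. *)
Lemma decomposes_id_frame (c1 c2 c3 : R) u1 u2 u3 :
  dot u1 u1 = 1 -> dot u2 u2 = 1 -> dot u3 u3 = 1 ->
  let p2 := dot u1 u2 in let s2 := dot (perp u1) u2 in
  let p3 := dot u1 u3 in let s3 := dot (perp u1) u3 in
  decomposes_id c1 c2 c3 u1 u2 u3 <->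
  [/\ c1 + c2 * p2 ^+ 2 + c3 * p3 ^+ 2 = 1,
      c2 * p2 * s2 + c3 * p3 * s3 = 0 &
      c2 * s2 ^+ 2 + c3 * s3 ^+ 2 = 1].
Proof.
move=> h1 h2 h3 /=.
have perp_perp : dot (perp u1) (perp u1) = 1.
  by rewrite -h1 !dotE !mxE /=; ring.
have u1_perp : dot u1 (perp u1) = 0 by rewrite !dotE !mxE /=; ring.
split=> [[_ _ _ hid]|[e1 e2 e3]].
  have pair v w : c1 * (dot v u1 * dot u1 w) + c2 * (dot v u2 * dot u2 w) +
      c3 * (dot v u3 * dot u3 w) = dot v w.
    by rewrite -{4}(hid v) /tens !dotDl !dotZl.
  have := (pair u1 u1, pair u1 (perp u1), pair (perp u1) (perp u1)).
  rewrite h1 perp_perp u1_perp ![dot (perp u1) u1]dotC u1_perp.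
  rewrite ![dot u2 _]dotC ![dot u3 _]dotC => -[[e1 e2] e3].
  by split; lra.
split; [exact/enorm1P|exact/enorm1P|exact/enorm1P|move=> v].
have [q [r def_v]] : exists q r, v = q *: u1 + r *: perp u1.
  by exists (dot u1 v), (dot (perp u1) v); exact: frame_expand.
rewrite /tens def_v !dotDl !dotZl.
rewrite h1 (dotC (perp u1) u1) u1_perp.
set p2 := dot u1 u2; set s2 := dot (perp u1) u2.
set p3 := dot u1 u3; set s3 := dot (perp u1) u3.
rewrite (frame_expand u2 h1) (frame_expand u3 h1) -/p2 -/s2 -/p3 -/s3.
have -> : q *: u1 + r *: perp u1 =
  (q * (c1 + c2 * p2 ^+ 2 + c3 * p3 ^+ 2) + r * (c2 * p2 * s2 + c3 * p3 * s3)) *: u1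
  + (q * (c2 * p2 * s2 + c3 * p3 * s3) +
     r * (c2 * s2 ^+ 2 + c3 * s3 ^+ 2)) *: perp u1.
  by rewrite e1 e2 e3 !mulr0 !mulr1 addr0 add0r.
by apply: row2P; rewrite !mxE; ring.
Qed.

End EuclideanPlane.

(** * The scalar equations in the frame of the first line *)

Definition sqrt_prod (R : rcfType) (c1 c2 c3 : R) : R :=
  Num.sqrt ((1 - c1) * (1 - c2) * (1 - c3)).

Lemma sqrt_prod_gt0 (R : rcfType) (c1 c2 c3 : R) :
  c1 < 1 -> c2 < 1 -> c3 < 1 -> 0 < sqrt_prod c1 c2 c3.
Proof. by move=> *; rewrite sqrtr_gt0 !mulr_gt0 ?subr_gt0. Qed.

Lemma sqr_sqrt_prod (R : rcfType) (c1 c2 c3 : R) :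
  c1 < 1 -> c2 < 1 -> c3 < 1 ->
  sqrt_prod c1 c2 c3 ^+ 2 = (1 - c1) * (1 - c2) * (1 - c3).
Proof.
by move=> *; rewrite sqr_sqrtr // ltW // -sqrtr_gt0; apply: sqrt_prod_gt0.
Qed.

Lemma frame_equations_sqr (R : realFieldType) (c1 c2 c3 p2 s2 p3 s3 : R) :
  c1 + c2 + c3 = 2 ->
  p2 ^+ 2 + s2 ^+ 2 = 1 -> p3 ^+ 2 + s3 ^+ 2 = 1 ->
  c1 + c2 * p2 ^+ 2 + c3 * p3 ^+ 2 = 1 ->
  c2 * p2 * s2 + c3 * p3 * s3 = 0 ->
  [/\ c1 * c2 * p2 ^+ 2 = (1 - c1) * (1 - c2), c1 * c2 * s2 ^+ 2 = 1 - c3,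
      c1 * c3 * p3 ^+ 2 = (1 - c1) * (1 - c3) & c1 * c3 * s3 ^+ 2 = 1 - c2].
Proof.
move=> hsum n2 n3 e1 e2.
have s2E : s2 ^+ 2 = 1 - p2 ^+ 2 by lra.
have s3E : s3 ^+ 2 = 1 - p3 ^+ 2 by lra.
have eqsq : (c2 * p2) ^+ 2 * (1 - p2 ^+ 2) = (c3 * p3) ^+ 2 * (1 - p3 ^+ 2).
  rewrite -s2E -s3E -!exprMn.
  by apply/eqP; rewrite eqf_sqr; apply/orP; right; apply/eqP; lra.
have c3E : c3 = 2 - c1 - c2 by lra.
have c3P : c3 * p3 ^+ 2 = 1 - c1 - c2 * p2 ^+ 2 by lra.
(* Once [c3 * p3 ^+ 2] is replaced by [1 - c1 - c2 * p2 ^+ 2], the terms of degree four in [p2]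
   cancel, leaving a linear equation for [p2 ^+ 2] with leading coefficient [c1 * c2] up to sign. *)
have eqc : c3 * (c3 * p3 ^+ 2) - (c3 * p3 ^+ 2) ^+ 2 =
       c2 * (c2 * p2 ^+ 2) - (c2 * p2 ^+ 2) ^+ 2.
  by transitivity ((c3 * p3) ^+ 2 * (1 - p3 ^+ 2)); [ring|rewrite -eqsq; ring].
have sq2 : c1 * c2 * p2 ^+ 2 = (1 - c1) * (1 - c2).
  by move: eqc; rewrite c3P c3E; lra.
have sq3 : c1 * (c3 * p3 ^+ 2) = (1 - c1) * (1 - c3).
  by rewrite c3P c3E; lra.
split=> //; rewrite ?s2E ?s3E.
- by rewrite c3E; lra.
- by rewrite -mulrA.
- by move: sq3; rewrite c3E; lra.
Qed.

Lemma frame_equationsP (R : rcfType) (c1 c2 c3 p2 s2 p3 s3 : R) :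
  0 < c1 -> c1 < 1 -> c2 < 1 -> c3 < 1 -> c1 + c2 + c3 = 2 ->
  p2 ^+ 2 + s2 ^+ 2 = 1 -> p3 ^+ 2 + s3 ^+ 2 = 1 ->
  [/\ c1 + c2 * p2 ^+ 2 + c3 * p3 ^+ 2 = 1,
      c2 * p2 * s2 + c3 * p3 * s3 = 0 &
      c2 * s2 ^+ 2 + c3 * s3 ^+ 2 = 1] <->
  exists e : R, (e = 1 \/ e = -1) /\
    (p2 * (1 - c3) = e * sqrt_prod c1 c2 c3 * s2 /\
     p3 * (1 - c2) = - e * sqrt_prod c1 c2 c3 * s3).
Proof.
move=> c1_gt0 c1_lt1 c2_lt1 c3_lt1 hsum n2 n3.
have := sqr_sqrt_prod c1_lt1 c2_lt1 c3_lt1.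
move: (sqrt_prod c1 c2 c3) => D D2.
have c1_neq0 : c1 != 0 by apply: lt0r_neq0.
have b_neq0 : 1 - c2 != 0 by apply: lt0r_neq0; lra.
have c_neq0 : 1 - c3 != 0 by apply: lt0r_neq0; lra.
split=> [[e1 e2 e3]|[e [he [k2 k3]]]].
  have [sq2 ss2 sq3 ss3] := frame_equations_sqr hsum n2 n3 e1 e2.
  (* The common sign is that of [p2 * s2], up to the factor [c1 * c2]: this product has square
     [D ^+ 2]. *)
  have [e [he q2]] : exists e : R,
      (e = 1 \/ e = -1) /\ c1 * c2 * p2 * s2 = e * D.
    have : (c1 * c2 * p2 * s2) ^+ 2 == D ^+ 2.
      by apply/eqP; rewrite D2 -sq2 -ss2; ring.
    rewrite eqf_sqr => /orP[] /eqP ->; [exists 1|exists (-1)].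
      by split; [left|ring].
    by split; [right|ring].
  exists e; split=> //.
  have q3 : c1 * c3 * p3 * s3 = - e * D.
    have : c1 * (c2 * p2 * s2 + c3 * p3 * s3) = 0 by rewrite e2 mulr0.
    by lra.
  by split; [rewrite -q2 -ss2|rewrite -q3 -ss3]; ring.
have s2E : 1 - p2 ^+ 2 = s2 ^+ 2 by lra.
have s3E : 1 - p3 ^+ 2 = s3 ^+ 2 by lra.
have e_sq : e ^+ 2 = 1 by case: he => ->; ring.
have c3E : c3 = 2 - c1 - c2 by lra.
(* Squaring [k2] and cancelling [1 - c3] leaves a linear equation for [p2 ^+ 2], whose coefficient
   [(1 - c3) + (1 - c1) * (1 - c2)] equals [c1 * c2] because the weights sum to 2. *)
have sq2 : c1 * c2 * p2 ^+ 2 = (1 - c1) * (1 - c2).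
  have : (1 - c3) * ((1 - c3) * p2 ^+ 2) =
         (1 - c3) * ((1 - c1) * (1 - c2) * (1 - p2 ^+ 2)).
    transitivity ((p2 * (1 - c3)) ^+ 2); first by ring.
    by rewrite k2 !exprMn e_sq D2 s2E; ring.
  by move/(mulfI c_neq0); rewrite c3E; lra.
have sq3 : c1 * c3 * p3 ^+ 2 = (1 - c1) * (1 - c3).
  have : (1 - c2) * ((1 - c2) * p3 ^+ 2) =
         (1 - c2) * ((1 - c1) * (1 - c3) * (1 - p3 ^+ 2)).
    transitivity ((p3 * (1 - c2)) ^+ 2); first by ring.
    by rewrite k3 !exprMn sqrrN e_sq D2 s3E; ring.
  by move/(mulfI b_neq0); rewrite c3E; lra.
have ss2 : c1 * c2 * s2 ^+ 2 = 1 - c3.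
  by rewrite -s2E c3E; lra.
have ss3 : c1 * c3 * s3 ^+ 2 = 1 - c2.
  by move: sq3; rewrite -s3E c3E; lra.
have q2 : c1 * c2 * p2 * s2 = e * D.
  apply: (mulIf c_neq0).
  by transitivity (c1 * c2 * s2 * (p2 * (1 - c3))); [ring|rewrite k2 -ss2; ring].
have q3 : c1 * c3 * p3 * s3 = - e * D.
  apply: (mulIf b_neq0).
  by transitivity (c1 * c3 * s3 * (p3 * (1 - c2))); [ring|rewrite k3 -ss3; ring].
(* Multiplied by [c1], each equation is a sum of the monomials just computed. *)
split; apply: (mulfI c1_neq0); [|lra|lra].
by move: sq3; rewrite c3E; lra.
Qed.

(** As [k] is nonzero, the two linear relations describe a single line through the origin; the
    factor between the two unit vectors is their dot product. *)
Lemma unit_collinear (R : realFieldType) (p s p' s' k m : R) :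
  p ^+ 2 + s ^+ 2 = 1 -> p' ^+ 2 + s' ^+ 2 = 1 -> k != 0 ->
  p * k = m * s -> p' * k = m * s' ->
  exists2 a : R, a != 0 & p' = a * p /\ s' = a * s.
Proof.
move=> n n' k_neq0 hk hk'.
have cross : p * s' = p' * s.
  apply: (mulIf k_neq0); rewrite -mulrAC hk -mulrA [s * _]mulrC mulrA -hk'; ring.
have pE : p' = (p * p' + s * s') * p.
  transitivity (p' * (p ^+ 2 + s ^+ 2)); first by rewrite n mulr1.
  transitivity (p * (p * p') + s * (p' * s)); first by ring.
  by rewrite -cross; ring.
have sE : s' = (p * p' + s * s') * s.
  transitivity (s' * (p ^+ 2 + s ^+ 2)); first by rewrite n mulr1.
  transitivity (p * (p * s') + s * (s * s')); first by ring.
  by rewrite cross; ring.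
exists (p * p' + s * s') => //; apply/eqP => a0.
rewrite a0 mul0r in pE; rewrite a0 mul0r in sE.
by move: n'; rewrite pE sE; lra.
Qed.

Lemma vline_scale (K : fieldType) (V : vectType K) (a : K) (v : V) :
  a != 0 -> <[a *: v]>%VS = <[v]>%VS.
Proof.
move=> a_neq0; apply/eqP; rewrite eqEsubv -!memvE memvZ ?memv_line //=.
by rewrite -{1}(scalerK a_neq0 v) memvZ ?memv_line.
Qed.

(** * Uniqueness of the three lines up to isometry *)

Section Decompositions.
Variables (R : realType) (c1 c2 c3 : R).
Implicit Types u v : 'rV[R]_2.

Lemma decomposes_idP u1 u2 u3 :
  0 < c1 -> c1 < 1 -> c2 < 1 -> c3 < 1 -> c1 + c2 + c3 = 2 ->
  dot u1 u1 = 1 -> dot u2 u2 = 1 -> dot u3 u3 = 1 ->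
  decomposes_id c1 c2 c3 u1 u2 u3 <->
  exists e : R, (e = 1 \/ e = -1) /\
    (dot u1 u2 * (1 - c3) = e * sqrt_prod c1 c2 c3 * dot (perp u1) u2 /\
     dot u1 u3 * (1 - c2) = - e * sqrt_prod c1 c2 c3 * dot (perp u1) u3).
Proof.
move=> ? ? ? ? ? h1 h2 h3.
rewrite decomposes_id_frame //; apply: frame_equationsP => //.
  by rewrite -h2 !expr2 -dot_frame.
by rewrite -h3 !expr2 -dot_frame.
Qed.

Lemma lines_decompose_id_isometry (L1 L2 L3 M1 M2 M3 : {vspace 'rV[R]_2}) :
  0 < c1 -> c1 < 1 -> c2 < 1 -> c3 < 1 -> c1 + c2 + c3 = 2 ->
  lines_decompose_id c1 c2 c3 L1 L2 L3 ->
  lines_decompose_id c1 c2 c3 M1 M2 M3 ->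
  exists f : 'End('rV[R]_2), linear_isometry f /\
    [/\ M1 = (f @: L1)%VS, M2 = (f @: L2)%VS & M3 = (f @: L3)%VS].
Proof.
move=> c1_gt0 c1_lt1 c2_lt1 c3_lt1 hsum.
move=> [u1 [u2 [u3 [-> -> -> hu]]]] [v1 [v2 [v3 [-> -> -> hv]]]].
have [/enorm1P nu1 /enorm1P nu2 /enorm1P nu3 _] := hu.
have [/enorm1P nv1 /enorm1P nv2 /enorm1P nv3 _] := hv.
have [e [he [hu2 hu3]]] :=
  (decomposes_idP c1_gt0 c1_lt1 c2_lt1 c3_lt1 hsum nu1 nu2 nu3).1 hu.
have [e' [he' [hv2 hv3]]] :=
  (decomposes_idP c1_gt0 c1_lt1 c2_lt1 c3_lt1 hsum nv1 nv2 nv3).1 hv.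
have sq1 (x : R) : x = 1 \/ x = -1 -> x ^+ 2 = 1 by case=> ->; ring.
have /sq1 ee_sq : e * e' = 1 \/ e * e' = -1.
  by case: he he' => -> [] ->; [left|right|right|left]; ring.
(* The frame is reflected exactly when the two solutions have opposite signs [e] and [e']. *)
pose f := linfun (map_frame u1 v1 (e * e')).
have b_neq0 : 1 - c2 != 0 by apply: lt0r_neq0; rewrite subr_gt0.
have c_neq0 : 1 - c3 != 0 by apply: lt0r_neq0; rewrite subr_gt0.
have line u v (k m : R) : dot u u = 1 -> dot v v = 1 -> k != 0 ->
    dot u1 u * k = e * m * dot (perp u1) u ->
    dot v1 v * k = e' * m * dot (perp v1) v -> <[v]>%VS = (f @: <[u]>)%VS.
  move=> nu nv k_neq0 hku hkv.
  have nfu : dot u1 u ^+ 2 + (e * e' * dot (perp u1) u) ^+ 2 = 1.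
    by rewrite exprMn ee_sq mul1r !expr2 -dot_frame.
  have nv' : dot v1 v ^+ 2 + dot (perp v1) v ^+ 2 = 1.
    by rewrite !expr2 -dot_frame.
  have hfu : dot u1 u * k = e' * m * (e * e' * dot (perp u1) u).
    rewrite hku; transitivity (e' ^+ 2 * (e * m * dot (perp u1) u)); last by ring.
    by rewrite (sq1 _ he') mul1r.
  have [a a_neq0 [pE sE]] := unit_collinear nfu nv' k_neq0 hfu hkv.
  rewrite limg_line -(vline_scale (f u) a_neq0); congr (<[_]>%VS).
  rewrite lfunE /= /map_frame scalerDr !scalerA -pE -sE.
  exact: frame_expand.
exists f; split; first exact: map_frame_isometry.
split; [|exact: line hu2 hv2|].
  rewrite limg_line; congr (<[_]>%VS).
  rewrite lfunE /= /map_frame nu1 (_ : dot (perp u1) u1 = 0).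
    by rewrite mulr0 scale0r scale1r addr0.
  by rewrite dotE !mxE /=; ring.
(* The third line has slope of the opposite sign, hence the minus before [sqrt_prod]. *)
apply: (line _ _ _ (- sqrt_prod c1 c2 c3) nu3 nv3 b_neq0).
  by rewrite hu3; ring.
by rewrite hv3; ring.
Qed.

End Decompositions.

(** * The cotangent formulas *)

Lemma cotP (R : realType) (x y : R) :
  y != 0 -> cot x = y <-> cos x = y * sin x.
Proof.
rewrite /cot => y_neq0; split=> [hy|cosE].
  (* If [sin x] vanished, [cot x] would take its default value 0, contrary to [y_neq0]. *)
  rewrite -hy divfK //; apply: contra y_neq0 => /eqP sin0.
  by rewrite -hy sin0 invr0 mulr0.
have sin_neq0 : sin x != 0.
  apply/eqP => sin0; have := cos2Dsin2 x.
  by rewrite cosE sin0 mulr0 expr0n addr0 => /eqP; rewrite eq_sym oner_eq0.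
by rewrite cosE mulfK.
Qed.

(** This brings the three square roots of the cotangent formulas to the common numerator
    [sqrt_prod c1 c2 c3]. *)
Lemma sqrtr_mul_div (R : rcfType) (a b c : R) :
  0 < c -> Num.sqrt (a * b / c) = Num.sqrt (a * b * c) / c.
Proof.
move=> c_gt0; have c_neq0 := lt0r_neq0 c_gt0.
have -> : a * b / c = (c^-1) ^+ 2 * (a * b * c) by field.
by rewrite [LHS]sqrtrM ?sqr_ge0 // sqrtr_sqr gtr0_norm ?invr_gt0 // mulrC.
Qed.

(** The addition formula for cotangents, cleared of denominators so that no sine has to be
    inverted. *)
Lemma cot_add_relation (R : realType) (x y k l m : R) :
  cos x = k * sin x -> cos y = l * sin y -> k * l + l * m + m * k = 1 ->
  cos (- (x + y)) = m * sin (- (x + y)).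
Proof.
move=> hx hy hkl; rewrite cosN sinN cosD sinD hx hy.
have -> : k * sin x * (l * sin y) - sin x * sin y =
  k * sin x * (l * sin y) - (k * l + l * m + m * k) * (sin x * sin y).
  by rewrite hkl mul1r.
ring.
Qed.

Lemma decomposes_id_cot (R : realType) (c1 c2 c3 t1 t2 t3 : R) :
  0 < c1 -> c1 < 1 -> c2 < 1 -> c3 < 1 -> c1 + c2 + c3 = 2 ->
  decomposes_id c1 c2 c3 (vec2 (cos t1) (sin t1))
    (vec2 (cos t2) (sin t2)) (vec2 (cos t3) (sin t3)) <->
  exists e : R, (e = 1 \/ e = -1) /\
    [/\ cot (t2 - t3) = e * Num.sqrt ((1 - c2) * (1 - c3) / (1 - c1)),
        cot (t3 - t1) = e * Num.sqrt ((1 - c3) * (1 - c1) / (1 - c2)) &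
        cot (t1 - t2) = e * Num.sqrt ((1 - c1) * (1 - c2) / (1 - c3))].
Proof.
move=> c1_gt0 c1_lt1 c2_lt1 c3_lt1 hsum.
have nt t : dot (vec2 (cos t) (sin t)) (vec2 (cos t) (sin t)) = 1.
  by rewrite dotE !vec2_0 !vec2_1 -!expr2 cos2Dsin2.
rewrite decomposes_idP //.
have a_gt0 : 0 < 1 - c1 by rewrite subr_gt0.
have b_gt0 : 0 < 1 - c2 by rewrite subr_gt0.
have c_gt0 : 0 < 1 - c3 by rewrite subr_gt0.
have D_gt0 := sqrt_prod_gt0 c1_lt1 c2_lt1 c3_lt1.
have D2 := sqr_sqrt_prod c1_lt1 c2_lt1 c3_lt1.
rewrite !sqrtr_mul_div //.
rewrite (_ : (1 - c2) * (1 - c3) * (1 - c1) =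
             (1 - c1) * (1 - c2) * (1 - c3)); last by ring.
rewrite (_ : (1 - c3) * (1 - c1) * (1 - c2) =
             (1 - c1) * (1 - c2) * (1 - c3)); last by ring.
rewrite -/(sqrt_prod c1 c2 c3).
set D := sqrt_prod c1 c2 c3 in D_gt0 D2 *.
have [a_neq0 b_neq0 c_neq0] :
    [/\ 1 - c1 != 0, 1 - c2 != 0 & 1 - c3 != 0] by split; apply: lt0r_neq0.
have e_neq0 (e : R) : e = 1 \/ e = -1 -> e != 0.
  by case=> ->; rewrite ?oppr_eq0 oner_eq0.
have y_neq0 (e k : R) : e = 1 \/ e = -1 -> k != 0 -> e * (D / k) != 0.
  by move=> /e_neq0 he hk; rewrite !mulf_neq0 ?invr_eq0 // lt0r_neq0.
have dot12 : dot (vec2 (cos t1) (sin t1)) (vec2 (cos t2) (sin t2)) = cos (t1 - t2).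
  by rewrite dotE !vec2_0 !vec2_1 cosB.
have perp12 : dot (perp (vec2 (cos t1) (sin t1))) (vec2 (cos t2) (sin t2)) =
    - sin (t1 - t2).
  by rewrite /perp dotE !vec2_0 !vec2_1 sinB; ring.
have dot13 : dot (vec2 (cos t1) (sin t1)) (vec2 (cos t3) (sin t3)) = cos (t3 - t1).
  by rewrite dotE !vec2_0 !vec2_1 cosB; ring.
have perp13 : dot (perp (vec2 (cos t1) (sin t1))) (vec2 (cos t3) (sin t3)) =
    sin (t3 - t1).
  by rewrite /perp dotE !vec2_0 !vec2_1 sinB; ring.
rewrite dot12 perp12 dot13 perp13.
have opp (e : R) : e = 1 \/ e = -1 -> - e = 1 \/ - e = -1.
  by case=> ->; rewrite ?opprK; [right|left].
split=> -[e [he]].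
  (* The sign flips because [perp12] produces [- sin (t1 - t2)], while the equation for the third
     line already carries [- e]. *)
  move=> [h12 h13]; exists (- e); split; first exact: opp.
  have h12' : cos (t1 - t2) = - e * (D / (1 - c3)) * sin (t1 - t2).
    by apply: (mulIf c_neq0); rewrite h12; field.
  have h13' : cos (t3 - t1) = - e * (D / (1 - c2)) * sin (t3 - t1).
    by apply: (mulIf b_neq0); rewrite h13; field.
  split; [|exact/cotP/h13'/y_neq0/b_neq0/opp|exact/cotP/h12'/y_neq0/c_neq0/opp].
  apply/cotP; first exact/y_neq0/a_neq0/opp.
  rewrite (_ : t2 - t3 = - ((t3 - t1) + (t1 - t2))); last by ring.
  apply: cot_add_relation h13' h12' _.
  (* Over the common denominator, the pairwise products of the cotangents add up to [D ^+ 2] times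
     the sum of the [1 - ci], and that sum is 1. *)
  transitivity (e ^+ 2 * (D ^+ 2 * (3 - (c1 + c2 + c3))) /
                ((1 - c1) * (1 - c2) * (1 - c3))).
    by field; rewrite a_neq0 b_neq0 c_neq0.
  have -> : e ^+ 2 = 1 by case: he => ->; ring.
  by rewrite hsum D2; field; rewrite a_neq0 b_neq0 c_neq0.
move=> [_ /cotP h13 /cotP h12]; exists (- e); split; first exact: opp.
by rewrite h12 ?h13 ?y_neq0 //; split; field.
Qed.

(** * The explicit solution and the conclusion *)

Lemma canonical_decomposes_id (R : realType) (c1 c2 c3 : R) :
  0 < c1 < 1 -> 0 < c2 < 1 -> 0 < c3 < 1 -> c1 + c2 + c3 = 2 ->
  decomposes_id c1 c2 c3 (vec2 1 0)
    (vec2 (Num.sqrt ((1 - c1) * (1 - c2) / (c1 * c2)))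
          (Num.sqrt ((1 - c3) / (c1 * c2))))
    (vec2 (- Num.sqrt ((1 - c1) * (1 - c3) / (c1 * c3)))
          (Num.sqrt ((1 - c2) / (c1 * c3)))).
Proof.
move=> /andP[c1_gt0 c1_lt1] /andP[c2_gt0 c2_lt1] /andP[c3_gt0 c3_lt1] hsum.
have a_gt0 : 0 < 1 - c1 by rewrite subr_gt0.
have b_gt0 : 0 < 1 - c2 by rewrite subr_gt0.
have c_gt0 : 0 < 1 - c3 by rewrite subr_gt0.
(* Unit length of the second vector comes from [(1 - c1) * (1 - c2) + (1 - c3) = c1 * c2], a
   rearrangement of [hsum]; exchanging [c2] and [c3] gives the third. *)
have unit_sum (a b d c c' : R) : 0 < a -> 0 < b -> 0 < d -> 0 < c -> 0 < c' ->
    a * b + d = c * c' ->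
    Num.sqrt (a * b / (c * c')) ^+ 2 + Num.sqrt (d / (c * c')) ^+ 2 = 1.
  move=> ? ? ? ? ? hcc.
  rewrite !sqr_sqrtr ?divr_ge0 ?mulr_ge0 ?ltW // -mulrDl hcc divff //.
  by rewrite mulf_neq0 ?lt0r_neq0.
have slope (a b d k : R) : 0 < a -> 0 < b -> 0 < d -> 0 < k ->
    Num.sqrt (a * b / k) * d = Num.sqrt (a * b * d) * Num.sqrt (d / k).
  move=> ? ? d_gt0 k_gt0; rewrite -[RHS]sqrtrM ?mulr_ge0 ?ltW //.
  have -> : a * b * d * (d / k) = d ^+ 2 * (a * b / k) by ring.
  by rewrite [RHS]sqrtrM ?sqr_ge0 // sqrtr_sqr gtr0_norm // mulrC.
rewrite decomposes_idP //.
(* The frame of [vec2 1 0] is the standard one, and the nonnegative coordinates of the second vector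
   call for the sign 1. *)
- exists 1; split; first by left.
  rewrite /perp !dotE !vec2_0 !vec2_1 /sqrt_prod; split.
    by rewrite !(mul0r, mul1r, oppr0, addr0, add0r) slope ?mulr_gt0.
  rewrite !(mul0r, mul1r, oppr0, addr0, add0r) mulNr slope ?mulr_gt0 //.
  by rewrite [_ * (1 - c3) * _]mulrAC; ring.
- by rewrite dotE vec2_0 vec2_1; ring.
- by rewrite dotE vec2_0 vec2_1 -!expr2 unit_sum //; lra.
- by rewrite dotE vec2_0 vec2_1 -!expr2 sqrrN unit_sum //; lra.
Qed.

Lemma lines_decompose_idI (R : realType) (c1 c2 c3 : R) (u1 u2 u3 : 'rV[R]_2) :
  decomposes_id c1 c2 c3 u1 u2 u3 ->
  lines_decompose_id c1 c2 c3 <[u1]>%VS <[u2]>%VS <[u3]>%VS.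
Proof. by exists u1, u2, u3. Qed.

Theorem proposition5 (R : realType) (c1 c2 c3 : R)
    (hc1 : 0 < c1 < 1) (hc2 : 0 < c2 < 1) (hc3 : 0 < c3 < 1)
    (hsum : c1 + c2 + c3 = 2) :
  let w1 : 'rV[R]_2 := vec2 1 0 in
  let w2 : 'rV[R]_2 := vec2 (Num.sqrt ((1 - c1) * (1 - c2) / (c1 * c2)))
                            (Num.sqrt ((1 - c3) / (c1 * c2))) in
  let w3 : 'rV[R]_2 := vec2 (- Num.sqrt ((1 - c1) * (1 - c3) / (c1 * c3)))
                            (Num.sqrt ((1 - c2) / (c1 * c3))) in
  [/\
    (exists L1 L2 L3 : {vspace 'rV[R]_2}, lines_decompose_id c1 c2 c3 L1 L2 L3),

    (forall L1 L2 L3 M1 M2 M3 : {vspace 'rV[R]_2},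
       lines_decompose_id c1 c2 c3 L1 L2 L3 ->
       lines_decompose_id c1 c2 c3 M1 M2 M3 ->
       exists f : 'End('rV[R]_2), linear_isometry f /\
         [/\ M1 = (f @: L1)%VS, M2 = (f @: L2)%VS & M3 = (f @: L3)%VS]),

    (forall t1 t2 t3 : R,
       decomposes_id c1 c2 c3 (vec2 (cos t1) (sin t1))
         (vec2 (cos t2) (sin t2)) (vec2 (cos t3) (sin t3)) <->
       exists e : R, (e = 1 \/ e = -1) /\
         [/\ cot (t2 - t3) = e * Num.sqrt ((1 - c2) * (1 - c3) / (1 - c1)),
             cot (t3 - t1) = e * Num.sqrt ((1 - c3) * (1 - c1) / (1 - c2)) &
             cot (t1 - t2) = e * Num.sqrt ((1 - c1) * (1 - c2) / (1 - c3))]),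

    decomposes_id c1 c2 c3 w1 w2 w3 &

    (forall L1 L2 L3 : {vspace 'rV[R]_2},
       lines_decompose_id c1 c2 c3 L1 L2 L3 <->
       exists f : 'End('rV[R]_2), linear_isometry f /\
         [/\ L1 = (f @: <[w1]>)%VS, L2 = (f @: <[w2]>)%VS &
             L3 = (f @: <[w3]>)%VS])].
Proof.
move=> w1 w2 w3.
have hw : decomposes_id c1 c2 c3 w1 w2 w3 by exact: canonical_decomposes_id.
have lw := lines_decompose_idI hw.
case/andP: (hc1) => c1_gt0 c1_lt1.
case/andP: (hc2) => _ c2_lt1; case/andP: (hc3) => _ c3_lt1.
split=> //.
- by exists <[w1]>%VS, <[w2]>%VS, <[w3]>%VS.
- by move=> *; apply: (@lines_decompose_id_isometry R c1 c2 c3).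
- by move=> *; apply: decomposes_id_cot.
(* Uniqueness, applied to the canonical triple and [hL], supplies the isometry; conversely,
   isometries carry decompositions to decompositions. *)
move=> L1 L2 L3; split=> [hL|[f [fi [-> -> ->]]]].
  by apply: (@lines_decompose_id_isometry R c1 c2 c3).
rewrite !limg_line; apply: lines_decompose_idI.
exact: linear_isometry_decomposes_id.
Qed.
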